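(* Let $X,Y$ be Banach spaces and let $u:\mathbb{R}_{\ge 0}\to\mathcal{L}(X;Y)$ be a function. Then the following are equivalent: (a) for each $x\in X$ there is $t_x\ge 0$ such that the orbit $u_x$ is locally of bounded variation on $(t_x,\infty)$; (b) there is $t\ge 0$ such that for all $x\in X$ the orbit $u_x$ is locally of bounded variation on $(t,\infty)$.
   Context: $X,Y$ are Banach spaces over the same field $\mathbb{R}$ or $\mathbb{C}$; $\mathcal{L}(X;Y)$ is the space of bounded linear operators from $X$ to $Y$; $\mathbb{R}_{\ge 0}=[0,\infty)$. No continuity or other regularity of $u$ is assumed. For $x\in X$, the orbit is the function $u_x:\mathbb{R}_{\ge 0}\to Y$, $u_x(t)=u(t)x$. For a function $f:J\to Y$ on an interval $J$ and a compact interval $K=[a,b]\subseteq J$, the total variation is $V_K(f)=\sup\{\sum_{j=1}^n\|f(t_j)-f(t_{j-1})\| : a=t_0<t_1<\dots<t_n=b\}$; $f$ is locally of bounded variation on $J$ if $V_K(f)<\infty$ for every compact interval $K\subseteq J$. *)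

(* Defs.v *)
From HB Require Import structures.
From mathcomp Require Export all_boot all_order all_algebra.
From mathcomp Require Export all_classical all_reals all_analysis.
From mathcomp Require Export complex.

Set Implicit Arguments.
Unset Strict Implicit.
Unset Printing Implicit Defensive.

Export Order.TTheory GRing.Theory Num.Theory.
Export numFieldNormedType.Exports.

Local Open Scope classical_set_scope.
Local Open Scope ring_scope.

Inductive scalar_kind := RealScalars | ComplexScalars.

Definition scalars (R : realType) (k : scalar_kind) : numFieldType :=
  match k with RealScalars => R | ComplexScalars => R[i] end.

(* The norm of a normedModType over K takes its values in K; here it is read as
   a real number. For K = R[i] nothing is lost: norms are nonnegative for the
   partial order of R[i], hence have zero imaginary part. *)
Definition rnorm (R : realType) (k : scalar_kind) :
    forall Y : normedModType (scalars R k), Y -> R :=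
  match k with
  | RealScalars => fun Y y => `|y|
  | ComplexScalars => fun Y y => complex.Re `|y|
  end.

Record bounded_linear (K : numFieldType) (X Y : normedModType K) :=
  BoundedLinear {
    bounded_linear_fun :> {linear X -> Y};
    bounded_linearP : exists M : K,
      forall x : X, `|bounded_linear_fun x| <= M * `|x| }.

(* The library's variation and total_variation (numfun, realfun) are restricted
   to real-valued functions on the real line. Here s = [:: t_1; ...; t_n] stands
   for the partition a = t_0 < t_1 < ... < t_n = b. *)
Section bounded_variation.
Context {R : realType} {k : scalar_kind} {Y : normedModType (scalars R k)}.
Context {d : Order.disp_t} {T : orderType d}.
Implicit Types (f : T -> Y) (a b : T) (s : seq T) (J : interval T).

Definition normed_variation a b f s : R := let F := f \o nth b (a :: s) in
  \sum_(0 <= j < size s) rnorm (F j.+1 - F j).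

Definition normed_total_variation a b f : \bar R :=
  ereal_sup [set (normed_variation a b f s)%:E | s in itv_partition a b].

Definition locally_bounded_variation J f : Prop :=
  forall a b, (a <= b)%O -> [set` `[a, b]] `<=` [set` J] ->
    (normed_total_variation a b f < +oo)%E.

End bounded_variation.

Definition op_orbit (R : realType) (k : scalar_kind)
    (X Y : normedModType (scalars R k))
    (u : {nonneg R} -> bounded_linear X Y) (x : X) : {nonneg R} -> Y :=
  fun t => u t x.

(* Main.v *)
Require Import Defs.
Local Open Scope classical_set_scope.
Local Open Scope ring_scope.

(** Only the passage from orbit-dependent to uniform [t] has content; it is a
    condensation of singularities. If no [t] works for all [x], then in
    particular no natural number [n] does, so for each [n] some compact interval
    [K n] of ]n, +oo[ carries an orbit of infinite variation. On the other hand
    the orbit of every single [x] has finite variation over [K n] as soon as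
    [t_x <= n]. Hence a contradiction arises once one vector is found whose
    orbit has infinite variation over all the intervals [K n] at once.

    For a fixed partition of [K n], the variation of the orbit of [x] along it
    is a continuous seminorm of [x], and the total variation is the supremum of
    these seminorms ([total_variation_lt_pinftyP]). So the vector is provided by
    the principle of condensation of singularities
    ([condensation_of_singularities]): in a Banach space, if for each [n] a
    family [P n] of continuous seminorms is unbounded at some point, then some
    point makes all these families unbounded. This in turn follows from Baire's
    theorem, applied to the sets where some member of [P n] exceeds [M]: they
    are open by continuity, and dense because seminorms that are unbounded at
    some point are unbounded on every ball.

    Real and complex scalars are treated together: [dense_bigcap_open] is the
    theorem of Baire for complete pseudometric spaces whose radii lie in any
    field where the inverses of the positive integers become arbitrarily small,
    which holds for both kinds of scalars. *)

(** A sequence of balls is chosen with radii [rad m = 1 / (m + 1)], so that only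
    natural numbers have to be compared even if [K] is only partially ordered.
    Since the double of each ball lies inside the preceding ball and inside the
    next open set, the limit of the centres, which is merely adherent to each
    ball, still belongs to all of the open sets. *)
Lemma dense_bigcap_open (K : numFieldType) (M : completePseudoMetricType K)
    (F : (set M)^nat) :
  (forall e : K, 0 < e -> exists n : nat, n.+1%:R^-1 < e) ->
  (forall i, open (F i)) -> (forall i, dense (F i)) -> dense (\bigcap_i F i).
Proof.
move=> archK openF denseF D D0 openD.
pose rad m : K := m.+1%:R^-1.
have rad_gt0 m : 0 < rad m by rewrite invr_gt0.
have le_rad m n : (m <= n)%N -> rad n <= rad m.
  by move=> mn; rewrite lef_pV2 ?posrE// ler_nat.
have shrink A n : open A -> A !=set0 ->
    exists q : M * nat, (n < q.2)%N /\ ball q.1 (2 * rad q.2) `<=` A.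
  move=> openA [x Ax].
  have /nbhs_ballP[e /= e0 xeA] : nbhs x A by exact: open_nbhs_nbhs.
  have [m me] := archK _ (divr_gt0 e0 (ltr0n K 2)).
  exists (x, maxn m n.+1); split; first exact: leq_maxr.
  apply: subset_trans xeA; apply: le_ball.
  rewrite mulrC -ler_pdivlMr//; apply: le_trans (ltW me).
  by apply: le_rad; exact: leq_maxl.
have [q0 [_ q0D]] := shrink D 0%N openD D0.
(* In an abstract pseudometric space balls need not be open, hence the interior. *)
have step (nq : nat * (M * nat)) : exists q : M * nat,
    (nq.2.2 < q.2)%N /\
    ball q.1 (2 * rad q.2) `<=` (ball nq.2.1 (rad nq.2.2))° `&` F nq.1.
  case: nq => n [x m] /=; apply: shrink.
    by apply: openI (openF n); exact: open_interior.
  apply: denseF; last exact: open_interior.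
  by exists x; apply: nbhsx_ballx.
have {step} [f f_step] := choice step.
pose a := fix a n := if n is p.+1 then f (p, a p) else q0.
have rad_a n : rad (a n).2 <= rad n.
  apply: le_rad; elim: n => //= n IHn.
  by apply: leq_ltn_trans IHn _; have [] := f_step (n, a n).
have nested n m : (n <= m)%N ->
    ball (a m).1 (rad (a m).2) `<=` ball (a n).1 (rad (a n).2).
  elim: m => [|m IHm]; first by rewrite leqn0 => /eqP ->.
  rewrite leq_eqVlt => /predU1P[->//|]; rewrite ltnS => /IHm.
  apply: subset_trans => x amx.
  have [_ /(_ x)] := f_step (m, a m) => -[|/interior_subset//].
  by apply: le_ball amx; rewrite ler_peMl ?ltW// ltr1n.
have a_in n m : (n <= m)%N -> ball (a n).1 (rad (a n).2) (a m).1.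
  by move=> nm; apply: (nested n m nm); exact: ballxx.
have /cauchy_cvg/cvg_ex[l al] : cauchy ((fst \o a) @ \oo).
  apply: cauchy_exP => e /archK[n ne]; exists (a n).1; exists n => // m /= nm.
  by apply: le_ball (a_in n m nm); exact: le_trans (rad_a n) (ltW ne).
have l_in n : ball (a n).1 (2 * rad (a n).2) l.
  have : \forall m \near \oo, ball l (rad (a n).2) (a m).1.
    by apply: al; exact: nbhsx_ballx.
  case=> N _ /(_ (maxn N n)) /(_ (leq_maxl _ _)) /ball_sym.
  rewrite mulr_natl mulr2n; apply: ball_triangle.
  by apply: a_in; exact: leq_maxr.
exists l; split; first by apply: q0D; exact: (l_in 0%N).
by move=> n _; have [_ /(_ l (l_in n.+1))[]] := f_step (n, a n).
Qed.

Lemma scalars_archimedean (R : realType) (k : scalar_kind) (e : scalars R k) :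
  0 < e -> exists n : nat, n.+1%:R^-1 < e.
Proof.
have archR (r : R) : 0 < r -> exists n : nat, n.+1%:R^-1 < r.
  move=> r0; exists (Num.trunc r^-1).
  by rewrite -ltf_pV2 ?posrE ??invr_gt0// invrK truncnS_gt.
case: k e => /= e; first exact: archR.
rewrite ltcE /= => /andP[/eqP e_im /archR[n ne]].
exists n; case: e e_im ne => re im /= -> ne.
by rewrite -(rmorph_nat (real_complex R)) -fmorphV/= ltcR.
Qed.

(** The two kinds of scalars give norms with values in different fields. Once
    these facts are known for [rnorm], no case analysis on scalars is left in
    the study of variations. *)
Section rnorm.
Context {R : realType} {k : scalar_kind}.
Implicit Type Y : normedModType (scalars R k).

Lemma rnormN Y (y : Y) : rnorm (- y) = rnorm y.
Proof. by case: k Y y => Y y /=; rewrite normrN. Qed.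

Lemma rnormD Y (y z : Y) : rnorm (y + z) <= rnorm y + rnorm z.
Proof.
case: k Y y z => Y y z /=; first exact: ler_normD.
by have := ler_normD y z; rewrite lecE -raddfD => /andP[].
Qed.

Lemma rnorm_continuous Y : continuous (@rnorm R k Y).
Proof.
case: k Y => Y /= y; first exact: norm_continuous.
apply/cvgrPdist_lt => e e0.
have e0C : (0 : R[i]) < e%:C%C by rewrite ltcR.
have := @norm_continuous _ Y y.
move=> /cvgrPdist_lt /(_ _ e0C); apply: filterS => z yz.
rewrite -ltcR; apply: le_lt_trans yz.
by rewrite -raddfB; exact: normc_ge_Re.
Qed.
End rnorm.

(** Density is the only place where unboundedness enters. Let [ball y e] be a
    ball, and [h] a multiple of [x] with [`|h| < e]. If a seminorm [p] is at
    most [M] at [y + h] and [y - h], then [p (2 h) <= 2 M] because [2 h] is the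
    difference of these two points, which bounds [p x] in terms of [h] and [M]
    alone. As [p] need only be subadditive and even, homogeneity is replaced by
    [p (x *+ m) <= p x *+ m]. *)
Lemma condensation_of_singularities (K : numFieldType) (R : realType)
    (X : completeNormedModType K) (P : nat -> set (X -> R)) :
  (forall e : K, 0 < e -> exists n : nat, n.+1%:R^-1 < e) ->
  (forall n p, P n p -> [/\ continuous p, forall x, p (- x) = p x
    & forall x y, p (x + y) <= p x + p y]) ->
  (forall n, exists x, forall M : nat, exists2 p, P n p & M%:R < p x) ->
  exists x, forall n (M : nat), exists2 p, P n p & M%:R < p x.
Proof.
move=> archK Pp unbdd.
pose U n M := [set x : X | exists2 p, P n p & M%:R < p x].
have openU n M : open (U n M).
  have -> : U n M = \bigcup_(p in P n) p @^-1` [set r : R | M%:R < r].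
    by apply/seteqP; split=> x [p Pnp Mx]; exists p.
  apply: bigcup_open => p /Pp[cp _ _]; apply: open_comp => [x _|].
    exact: cp.
  exact: open_gt.
have p_mulrn n p x m : P n p -> p (x *+ m.+1) <= p x *+ m.+1.
  move=> /Pp[_ _ pD]; elim: m => [//|m IHm].
  by rewrite mulrS (mulrS (p x)); apply: le_trans (pD _ _) _; rewrite lerD2l.
have denseU n M : dense (U n M).
  move=> D [y Dy] openD; have [x x_unbdd] := unbdd n.
  have /nbhs_ballP[e /= e0 yeD] : nbhs y D by exact: open_nbhs_nbhs.
  have x1_gt0 : 0 < `|x| + 1 by rewrite ltr_wpDl.
  have [m me] := archK _ (divr_gt0 e0 x1_gt0).
  pose h := ((2 * m.+1)%N%:R : K)^-1 *: x.
  have xE : x = h *+ 2 *+ m.+1.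
    by rewrite -mulrnA -[RHS]scaler_nat scalerA mulfV ?scale1r ?pnatr_eq0.
  have he : `|h| < e.
    move: me; rewrite ltr_pdivlMr//; apply: le_lt_trans.
    rewrite normrZ normfV normr_nat ler_pM ?invr_ge0 ?ler0n ?lerDl//.
    by rewrite lef_pV2 ?posrE// ?ltr0n// ler_nat leq_pmull.
  have [p Pnp px] := x_unbdd ((M + M) * m.+1)%N.
  have [_ pN pD] := Pp n p Pnp.
  have pyh : (M + M)%:R < p (y + h) + p (y - h).
    have : p (h *+ 2) <= p (y + h) + p (y - h).
      rewrite -(pN (y - h)); apply: le_trans (pD _ _).
      by rewrite opprB [h - y]addrC addrACA subrr add0r mulr2n.
    apply: lt_le_trans; rewrite -(ltr_pMn2r (ltn0Sn m)) -mulrnA.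
    by apply: lt_le_trans px _; rewrite xE; exact: (p_mulrn n).
  have [Mh|hM] := ltP M%:R (p (y + h)).
    exists (y + h); split; last by exists p.
    by apply: yeD; rewrite -ball_normE /= opprD addNKr normrN.
  exists (y - h); split.
    by apply: yeD; rewrite -ball_normE /= opprB addrC subrK.
  exists p => //; rewrite ltNge; apply/negP => hM'.
  by move: pyh; rewrite ltNge natrD lerD.
(* Pairs (n, M) are encoded as natural numbers; non-codes fall back on (0, 0). *)
pose G i := let q := odflt (0, 0)%N (unpickle i) in U q.1 q.2.
have denseG : dense (\bigcap_i G i).
  by apply: dense_bigcap_open => // i; [exact: openU|exact: denseU].
have [x [_ Gx]] := denseG setT (ex_intro _ 0 I) openT.
by exists x => n M; have := Gx (pickle (n, M)) I; rewrite /G pickleK.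
Qed.

Lemma bounded_linear_fun_continuous (K : numFieldType)
    (X Y : normedModType K) (f : bounded_linear X Y) : continuous f.
Proof.
apply: bounded_linear_continuous; apply/linear_boundedP.
have [M fM] := bounded_linearP f.
(* M may fail to be real when X is trivial, hence the bound `|M|. *)
near=> r => x; have Mx_ge0 : 0 <= M * `|x| by exact: le_trans (fM x).
apply: le_trans (fM x) _; rewrite -(ger0_norm Mx_ge0) normrM normr_id.
by apply: ler_wpM2r => //; near: r; apply: nbhs_pinfty_ge; exact: normr_real.
Unshelve. all: by end_near. Qed.

Section variation_of_orbits.
Context {R : realType} {k : scalar_kind} {X Y : normedModType (scalars R k)}.
Variable u : {nonneg R} -> bounded_linear X Y.
Implicit Types (a b : {nonneg R}) (s : seq {nonneg R}).

Lemma normed_variation_continuous a b s :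
  continuous (fun x => normed_variation a b (op_orbit u x) s).
Proof.
apply: continuous_big; first exact: add_continuous.
move=> j _ x /=; pose t i := nth b (a :: s) i.
apply: (@continuous_comp X Y R (fun z => u (t j.+1) z - u (t j) z)
  (@rnorm R k Y)).
  by apply: cvgB; exact: bounded_linear_fun_continuous.
exact: rnorm_continuous.
Qed.

Lemma normed_variationN a b s x :
  normed_variation a b (op_orbit u (- x)) s =
  normed_variation a b (op_orbit u x) s.
Proof.
apply: eq_bigr => j _.
by rewrite /op_orbit /= !linearN -opprD rnormN.
Qed.

Lemma normed_variationD a b s x y :
  normed_variation a b (op_orbit u (x + y)) s <=
  normed_variation a b (op_orbit u x) s + normed_variation a b (op_orbit u y) s.
Proof.
rewrite -big_split /=; apply: ler_sum => j _.
by rewrite /op_orbit /= !linearD /= addrACA rnormD.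
Qed.
End variation_of_orbits.

Lemma total_variation_lt_pinftyP (R : realType) (k : scalar_kind)
    (Y : normedModType (scalars R k)) (d : Order.disp_t) (T : orderType d)
    (a b : T) (f : T -> Y) :
  (normed_total_variation a b f < +oo)%E <->
  exists M : nat, forall s, itv_partition a b s ->
    normed_variation a b f s <= M%:R.
Proof.
split=> [|[M fM]].
  have ub s : itv_partition a b s ->
      ((normed_variation a b f s)%:E <= normed_total_variation a b f)%E.
    by move=> abs; apply: ereal_sup_ubound; exists s.
  case: normed_total_variation ub => [v| |] ub // _.
    exists (Num.trunc v).+1 => s /ub; rewrite lee_fin => /le_trans; apply.
    exact/ltW/truncnS_gt.
  by exists 0%N => s /ub.
apply: (@le_lt_trans _ _ (M%:R%:E)); last exact: ltry.
by apply: ge_ereal_sup => _ [s /fM sM <-]; rewrite lee_fin.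
Qed.

Theorem proposition3p8 (R : realType) (k : scalar_kind)
    (X Y : completeNormedModType (scalars R k))
    (u : {nonneg R} -> bounded_linear X Y) :
  (forall x : X, exists t_x : {nonneg R},
    locally_bounded_variation `]t_x, +oo[ (op_orbit u x))
  <->
  (exists t : {nonneg R}, forall x : X,
    locally_bounded_variation `]t, +oo[ (op_orbit u x)).
Proof.
split=> [lbv|[t lbv] x]; last by exists t.
apply: contrapT => no_t.
have /choice[K infK] : forall n : nat, exists ab : {nonneg R} * {nonneg R},
    [/\ (ab.1 <= ab.2)%O, [set` `[ab.1, ab.2]] `<=` [set` `]n%:R%:nng, +oo[] &
     exists x, ~ (normed_total_variation ab.1 ab.2 (op_orbit u x) < +oo)%E].
  move=> n; apply: contrapT => no_K; apply: no_t.
  exists (n%:R%:nng) => x a b ab abJ; apply: contrapT => infab.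
  apply: no_K; exists (a, b); split => //.
  by exists x.
pose var n s x := normed_variation (K n).1 (K n).2 (op_orbit u x) s.
pose P n := [set var n s | s in itv_partition (K n).1 (K n).2].
have infP n x : (forall M : nat, exists2 p, P n p & M%:R < p x) <->
    ~ (normed_total_variation (K n).1 (K n).2 (op_orbit u x) < +oo)%E.
  rewrite total_variation_lt_pinftyP; split=> [Px [M xM]|xnM M].
    by have [_ [s Ks <-]] := Px M; rewrite ltNge xM.
  apply: contrapT => nP; apply: xnM; exists M => s Ks.
  rewrite leNgt; apply/negP => Ms; apply: nP.
  by exists (var n s) => //; exists s.
have [||n|x xP] := @condensation_of_singularities _ R X P.
- exact: scalars_archimedean.
- move=> n _ [s _ <-]; split=> [|x|x y].
  + exact: normed_variation_continuous.
  + exact: normed_variationN.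
  + exact: normed_variationD.
- by have [_ _ [x infx]] := infK n; exists x; apply/infP.
have [t tx] := lbv x.
pose n := (Num.trunc t%:num).+1.
have [Kle KJ _] := infK n.
have /infP := xP n; apply; apply: tx => // r /KJ /=.
rewrite !in_itv /= !andbT; apply: lt_trans.
exact: truncnS_gt.
Qed.
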